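(* Let $Y\in\mathbb R^{m\times n}$ with $n\ge 1$, and let $\sigma\in\mathbb R^m$ be such that $P(Y,\sigma)$ is a non-empty entirely simple polytope with vertex index sets $\mathcal V=\{\mathcal V_1,\ldots,\mathcal V_{\overline m}\}$, associated matrices $V_1,\ldots,V_{\overline m}\in\mathbb R^{n\times m}$, and vertex configuration domain $\mathbb Y_{\mathcal V}=\{y\in\mathbb R^m : Ey\le 0\}$. Then for all $y\in\mathbb Y_{\mathcal V}$, $$P(Y,y)=\mathrm{conv}(V_1y,V_2y,\ldots,V_{\overline m}y),$$ where $\mathrm{conv}$ denotes the convex hull.
   Context: For $y\in\mathbb R^m$ let $P(Y,y)=\{x\in\mathbb R^n : Yx\le y\}$; a polytope is a bounded polyhedron. For $I\subseteq\{1,\ldots,m\}$, $Y_I$ and $y_I$ denote the rows of $Y$ and entries of $y$ with index in $I$, and $\mathcal F_I(y)=\{x\in P(Y,y): Y_I x\ge y_I\}$. The polyhedron $P(Y,y)$ is entirely simple if every $I\subseteq\{1,\ldots,m\}$ with $\mathcal F_I(y)\neq\varnothing$ satisfies $\mathrm{rank}(Y_I)=|I|$ (the empty matrix has rank $0$). Given $\sigma$, let $\mathcal V=\{\mathcal V_1,\ldots,\mathcal V_{\overline m}\}$ be the collection of all $I\subseteq\{1,\ldots,m\}$ with $|I|=n$ and $\mathcal F_I(\sigma)\neq\varnothing$. Since $P(Y,\sigma)$ is entirely simple, the $n\times n$ matrices $Y_{\mathcal V_i}$ are invertible; set $V_i=Y_{\mathcal V_i}^{-1}\mathbb 1_{\mathcal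 V_i}$, where $\mathbb 1_{\mathcal V_i}\in\mathbb R^{n\times m}$ consists of the rows of the $m\times m$ identity matrix $\mathbb 1$ with index in $\mathcal V_i$, so that $V_iy=Y_{\mathcal V_i}^{-1}y_{\mathcal V_i}$. The matrix $E\in\mathbb R^{(\overline m m)\times m}$ is obtained by stacking the blocks $YV_i-\mathbb 1$, $i=1,\ldots,\overline m$, on top of each other. *)

(* Defs.v *)
From HB Require Import structures.
From mathcomp Require Import all_boot all_order all_algebra.
From mathcomp Require Import all_classical all_reals all_analysis.
Set Implicit Arguments.
Unset Strict Implicit.
Unset Printing Implicit Defensive.
Import Order.TTheory GRing.Theory Num.Theory.
Import numFieldNormedType.Exports.
Local Open Scope classical_set_scope.
Local Open Scope ring_scope.

Section ConfigurationDomain.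
Variable R : realType.

Definition mxle p q (A B : 'M[R]_(p, q)) : Prop := forall i j, A i j <= B i j.

(* The selected rows keep their relative order, since enum lists ordinals
   increasingly. *)
Definition rows_at m p (I : {set 'I_m}) (A : 'M[R]_(m, p)) : 'M[R]_(#|I|, p) :=
  rowsub (@enum_val _ (mem I)) A.

Definition convex_hull (V : lmodType R) (A : set V) : set V :=
  smallest (@convex_set R V) A.

Variables m n : nat.
Implicit Types (Y : 'M[R]_(m, n)) (y : 'cV[R]_m) (I : {set 'I_m}).

Definition polyhedron Y y : set 'cV[R]_n := [set x | mxle (Y *m x) y].

Definition face Y y I : set 'cV[R]_n :=
  [set x | polyhedron Y y x /\ mxle (rows_at I y) (rows_at I Y *m x)].

Definition entirely_simple Y y : Prop :=
  forall I, face Y y I !=set0 -> \rank (rows_at I Y) = #|I|.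

Definition is_polytope Y y : Prop := bounded_set (polyhedron Y y).

Definition vertex_sets Y y : {set {set 'I_m}} :=
  [set I : {set 'I_m} | (#|I| == n) && `[< face Y y I !=set0 >]]%SET.

Definition nvertices Y y : nat := #|vertex_sets Y y|.

Definition vertex_set Y y (i : 'I_(nvertices Y y)) : {set 'I_m} := enum_val i.

Lemma card_vertex_set Y y (i : 'I_(nvertices Y y)) : #|vertex_set i| = n.
Proof. by have := enum_valP i; rewrite inE => /andP[/eqP]. Qed.

(* [rows_at (vertex_set i) A], with its row dimension cast from #|vertex_set i|
   to n so that the case A = Y is a square matrix that [invmx] applies to. *)
Definition vertex_rows Y y (i : 'I_(nvertices Y y)) p (A : 'M[R]_(m, p)) :
    'M[R]_(n, p) :=
  castmx (card_vertex_set i, erefl p) (rows_at (vertex_set i) A).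

(* [invmx] is the genuine inverse under [entirely_simple Y y]: see
   [vertex_rows_unit]. *)
Definition vertex_mx Y y (i : 'I_(nvertices Y y)) : 'M[R]_(n, m) :=
  invmx (vertex_rows i Y) *m vertex_rows i 1%:M.

Lemma vertex_rows_unit Y y (i : 'I_(nvertices Y y)) :
  entirely_simple Y y -> vertex_rows i Y \in unitmx.
Proof.
move=> simpY; rewrite -row_free_unit /row_free /vertex_rows.
have := enum_valP i; rewrite inE => /andP[_ /asboolP /simpY].
rewrite -/(vertex_set i) => rkY.
have rk_cast q (e : #|vertex_set i| = q) (A : 'M[R]_(#|vertex_set i|, n)) :
  \rank (castmx (e, erefl n) A) = \rank A by case: q / e.
by rewrite rk_cast rkY card_vertex_set.
Qed.

Lemma vertex_mxM Y y (i : 'I_(nvertices Y y)) (z : 'cV[R]_m) :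
  vertex_mx i *m z = invmx (vertex_rows i Y) *m vertex_rows i z.
Proof.
rewrite -mulmxA; congr (_ *m _).
apply/matrixP => a b; rewrite /vertex_rows mxE castmxE /rows_at !mxE.
rewrite (bigD1 (enum_val (cast_ord (esym (card_vertex_set i)) a))) //=.
rewrite big1 => [|j /negPf jNi]; last first.
  by rewrite castmxE !mxE eq_sym cast_ord_id jNi mul0r.
by rewrite castmxE !mxE !cast_ord_id eqxx mul1r addr0.
Qed.

(* The height \sum_(i < nvertices Y y) m is nvertices Y y * m, in the form that
   \mxcol produces. *)
Definition config_mx Y y :
    'M[R]_(\sum_(i < nvertices Y y) m, m) :=
  \mxcol_(i < nvertices Y y) (Y *m vertex_mx i - 1%:M).

Definition config_domain Y y : set 'cV[R]_m :=
  [set z | mxle (config_mx Y y *m z) 0].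

End ConfigurationDomain.

(* Main.v *)
(** For [c] a row vector, [P(Y, sigma)] has a vertex maximizing [c]: from any
    point one reaches a vertex without decreasing [c], by moving along the kernel
    of the active rows until a new constraint becomes active, and there are
    finitely many vertices.  As the polytope is simple, the rows active at that
    vertex [V_i sigma] form an invertible matrix, and optimality puts [c] in
    their cone, so the normal cones of the vertices cover the whole space.  This
    certificate does not mention [sigma]: if [c] separated [x] in [P(Y, y)]
    strictly from all the [V_k y], then writing [c] as a nonnegative combination
    of the rows [Y_{V_i}] would give [c x <= c V_i y]. *)
Require Import Defs.
From HB Require Import structures.
From mathcomp Require Import all_boot all_order all_algebra.
From mathcomp Require Import all_classical all_reals all_analysis.
From mathcomp Require Import zify ring lra.
Import Order.TTheory GRing.Theory Num.Theory.
Import numFieldNormedType.Exports.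
Set Implicit Arguments.
Unset Strict Implicit.
Unset Printing Implicit Defensive.
Local Open Scope classical_set_scope.
Local Open Scope ring_scope.

Local Notation "''[' c , a ]" := ((c *m a) 0 0) (format "''[' c ,  a ]").

(** * Row-column pairing and Farkas' lemma *)

Section Pairing.
Variables (R : realFieldType) (k : nat).
Implicit Types (c : 'rV[R]_k) (a : 'cV[R]_k).

Lemma pairBl c c' a : '[c - c', a] = '[c, a] - '[c', a].
Proof. by rewrite mulmxBl !mxE. Qed.

Lemma pairZl t c a : '[t *: c, a] = t * '[c, a].
Proof. by rewrite -scalemxAl [LHS]mxE. Qed.

Lemma pairZr t c a : '[c, t *: a] = t * '[c, a].
Proof. by rewrite -scalemxAr [LHS]mxE. Qed.

Lemma pair_lineE t c a a' : '[c, a + t *: a'] = '[c, a] + t * '[c, a'].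
Proof. by rewrite mulmxDr [LHS]mxE pairZr. Qed.

Lemma pairBr c a a' : '[c, a - a'] = '[c, a] - '[c, a'].
Proof. by rewrite mulmxBr !mxE. Qed.

Lemma pair_tr_gt0 a : a != 0 -> 0 < '[a^T, a].
Proof.
move=> a0; have sq_ge0 j : 0 <= a^T 0 j * a j 0 by rewrite mxE -expr2 sqr_ge0.
rewrite lt_neqAle mxE sumr_ge0// andbT eq_sym; apply: contra_neq a0 => /eqP.
rewrite psumr_eq0// => /allP a0; apply/colP => j; rewrite mxE; apply/eqP.
by have := a0 j (mem_index_enum _); rewrite mxE mulf_eq0 orbb.
Qed.

(** By induction on the number of generators. A functional [c] that separates [b] from the first [N]
    of them can only fail at the last one, [e]; if it does, ['[c, e]] is positive and the problem is
    reduced modulo [e]. *)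
Lemma farkas N (a : 'I_N -> 'cV[R]_k) (b : 'cV[R]_k) :
  (exists2 l : 'I_N -> R, forall i, 0 <= l i & b = \sum_i l i *: a i) \/
  (exists2 c : 'rV[R]_k, forall i, '[c, a i] <= 0 & 0 < '[c, b]).
Proof.
elim: N a b => [|N IHN] a b.
  have [->|b0] := eqVneq b 0; last first.
    by right; exists b^T => [[]//|]; exact: pair_tr_gt0.
  by left; exists (fun=> 0); rewrite ?big_ord0.
pose a' i := a (widen_ord (leqnSn _) i); pose e := a ord_max.
have split_ord (Q : 'I_N.+1 -> Prop) :
    (forall i, Q (widen_ord (leqnSn _) i)) -> Q ord_max -> forall i, Q i.
  move=> Qw Qm i; case: (unliftP ord_max i) => [j ->|->]//.
  by rewrite (_ : lift _ _ = widen_ord (leqnSn _) j)//; apply/val_inj/lift_max.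
case: (IHN a' b) => [[l l0 ->]|[c ca cb]].
  left; exists (fun i => oapp l 0 (unlift ord_max i)) => [i|].
    by case: unlift => /=.
  rewrite big_ord_recr/= unlift_none scale0r addr0; apply: eq_bigr => i _.
  congr (_ *: _); rewrite (_ : widen_ord _ _ = lift ord_max i) ?liftK//.
  by apply/val_inj/esym/lift_max.
have [ce|ce] := lerP '[c, e] 0; first by right; exists c => //; apply: split_ord.
(* Project along [e] onto the hyperplane on which [c] vanishes. *)
pose pr v : 'cV[R]_k := v - ('[c, v] / '[c, e]) *: e.
case: (IHN (pr \o a') (pr b)) => [[l l0 prb]|[d da db]]; [left|right].
  (* The coefficient of [e] restores what the projection removed from [b] and from the [a' i]. It is
     nonnegative because [c] is positive at [b] and nonpositive at each [a' i]. *)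
  pose le := '[c, b] / '[c, e] - \sum_i l i * ('[c, a' i] / '[c, e]).
  exists (fun i => oapp l le (unlift ord_max i)) => [i|].
    case: unlift => //=; rewrite subr_ge0 (@le_trans _ _ 0)//; last first.
      by rewrite divr_ge0 ?ltW.
    apply: sumr_le0 => j _; rewrite mulr_ge0_le0// mulr_le0_ge0// invr_ge0.
    exact: ltW.
  rewrite big_ord_recr/= unlift_none /=.
  under eq_bigr => i _.
    rewrite (_ : widen_ord _ _ = lift ord_max i); last exact/val_inj/esym/lift_max.
    rewrite liftK/= (_ : a _ = a' i); last by congr a; exact/val_inj/lift_max.
    over.
  have -> : b = pr b + ('[c, b] / '[c, e]) *: e by rewrite subrK.
  rewrite prb /le scalerBl addrA [RHS]addrAC; congr (_ + _).
  rewrite scaler_suml -sumrB; apply: eq_bigr => i _.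
  by rewrite scalerBr scalerA.
(* The composite of [d] with [pr] is again a pairing with a row vector, and it vanishes at [e]. *)
have pairpr v : '[d - ('[d, e] / '[c, e]) *: c, v] = '[d, pr v].
  by rewrite pairBl pairZl pairBr pairZr mulrAC [_ * '[c, v]]mulrC mulrAC.
exists (d - ('[d, e] / '[c, e]) *: c); last by rewrite pairpr.
apply: split_ord => [i|]; rewrite pairpr//; first exact: da.
by rewrite /pr divff ?gt_eqF// scale1r subrr mulmx0 mxE.
Qed.
End Pairing.

(** * Finite convex combinations *)

Section Convex.
Variables (R : realFieldType) (V : lmodType R).

Lemma convex_set_sum (A : set V) N (a : 'I_N -> V) (l : 'I_N -> R) :
    convex_set A -> (forall i, A (a i)) -> (forall i, 0 <= l i) ->
  \sum_i l i = 1 -> A (\sum_i l i *: a i).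
Proof.
move=> cA Aa l0 l1.
(* Partial sums of the weights no longer total 1, so the induction runs over weighted means of
   positive total weight. *)
suff : 0 < \sum_i l i -> A ((\sum_i l i)^-1 *: \sum_i l i *: a i).
  by rewrite l1 invr1 scale1r; apply; exact: ltr01.
elim: N a l Aa l0 {l1} => [|N IHN] a l Aa l0; first by rewrite big_ord0 ltxx.
rewrite !big_ord_recr/=; set s := \sum_(i < N) _; set z := \sum_(i < N) _.
set t := l ord_max; have t0 : 0 <= t by exact: l0.
have : 0 <= s by apply: sumr_ge0.
(* If the first [N] weights total 0, they all vanish and the mean is the last point; the induction
   hypothesis covers only [0 < s]. *)
rewrite le_eqVlt => /predU1P[s0|s0].
  rewrite -s0 add0r => t_gt0.
  have -> : z = 0.
    apply: big1 => i _; suff -> : l (widen_ord (leqnSn _) i) = 0 by rewrite scale0r.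
    move/esym/eqP : s0; rewrite psumr_eq0// => /allP/(_ i (mem_index_enum _)).
    by move/eqP.
  by rewrite add0r scalerA mulVf ?gt_eqF// scale1r.
move=> st0.
have k0 : 0 <= s / (s + t) by rewrite divr_ge0 ?ltW.
have k1 : s / (s + t) <= 1 by rewrite ler_pdivrMr// mul1r lerDl.
have := cA (s^-1 *: z) (a ord_max) (Itv01 k0 k1).
rewrite !inE => /(_ (IHN _ _ _ _ s0) (Aa _)).
have -> : (s + t)^-1 *: (z + t *: a ord_max) =
  (s / (s + t)) *: (s^-1 *: z) + (1 - s / (s + t)) *: a ord_max.
  rewrite scalerDr !scalerA; congr (_ *: _ + _ *: _).
    by field; rewrite !gt_eqF.
  by field; rewrite gt_eqF.
by apply => i; [exact: Aa | exact: l0].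
Qed.
End Convex.

(** * Strict separation from the hull of finitely many points *)

Section Separation.
Variables (R : realType) (n : nat).

(** Homogenization: with a coordinate 1 appended, conic combinations equal to the lifted [x] are
    convex combinations equal to [x]. In the other case of [farkas], the last entry of the
    functional adds the same constant on both sides and cancels. *)
Lemma convex_hull_separation N (p : 'I_N -> 'cV[R]_n) (x : 'cV[R]_n) :
  ~ convex_hull [set p i | i in [set: 'I_N]] x ->
  exists c : 'rV[R]_n, forall i, '[c, p i] < '[c, x].
Proof.
move=> xNhull.
case: (farkas (fun i => col_mx (p i) (1%:M : 'cV[R]_1)) (col_mx x 1%:M)).
  case=> l l0 E; exfalso; apply: xNhull.
  have usum : x = \sum_i l i *: p i.
    move/(congr1 usubmx) : E; rewrite col_mxKu => ->; rewrite linear_sum.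
    by apply: eq_bigr => i _; rewrite linearZ/= col_mxKu.
  have dsum : \sum_i l i = 1.
    move/(congr1 (fun M : 'cV[R]_(n + 1) => dsubmx M 0 0)) : E.
    rewrite col_mxKd mxE eqxx mulr1n => ->; rewrite linear_sum summxE.
    by apply: eq_bigr => i _; rewrite linearZ/= col_mxKd !mxE eqxx mulr1.
  move=> A [cA pA]; rewrite usum; apply: convex_set_sum => // i.
  by apply: pA; exists i.
case=> c cp cx; exists (lsubmx c) => i.
have := le_lt_trans (cp i) cx.
rewrite -[c]hsubmxK !mul_row_col !mulmx1 row_mxKl.
by rewrite [X in X < _]mxE [X in _ < X]mxE ltrD2r.
Qed.
End Separation.

(** * Vertices and normal cones of a simple polytope *)

Section Polytope.
Variables (R : realType) (m n : nat) (Y : 'M[R]_(m, n)) (y : 'cV[R]_m).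
Implicit Types (x d : 'cV[R]_n) (c : 'rV[R]_n) (i : 'I_(nvertices Y y)).

Definition active x : {set 'I_m} := [set j | (Y *m x) j 0 == y j 0]%SET.

Lemma mulmx_lineE x t d j :
  (Y *m (x + t *: d)) j 0 = (Y *m x) j 0 + t * (Y *m d) j 0.
Proof. by rewrite mulmxDr -scalemxAr mxE [X in _ + X]mxE. Qed.

Lemma polytope_no_recession x d :
    is_polytope Y y -> polyhedron Y y x -> d != 0 ->
  exists j, 0 < (Y *m d) j 0.
Proof.
move=> bP Px d0; apply: contrapT => /forallNP dneg.
have [M M0 /= PM] := ex_strict_bound_gt0 bP.
have dgt0 : 0 < `|d| by rewrite normr_gt0.
(* This step has length [2 * M], while two points of norm less than [M] are closer than that. *)
pose t := 2 * M / `|d|; have t0 : 0 <= t by rewrite divr_ge0 ?mulr_ge0 ?ltW.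
have := PM (x + t *: d) _; have := PM x Px => xM.
have /[swap] /[apply] xtM : polyhedron Y y (x + t *: d).
  move=> j k; rewrite ord1 mulmx_lineE (le_trans _ (Px j 0))// gerDl.
  by rewrite mulr_ge0_le0// leNgt; apply/negP/dneg.
have : `|t *: d| = 2 * M by rewrite normrZ ger0_norm// divfK// gt_eqF.
have : `|t *: d| <= `|x + t *: d| + `|x|.
  by rewrite (le_trans _ (ler_normB _ _))// addrAC subrr add0r.
by move: xM xtM; lra.
Qed.

(** The ratio test of the simplex method: the longest feasible step is the least quotient of slack
    by growth rate over the rows that grow along [d], and a minimizing row becomes active. *)
Lemma ratio_step x d :
    is_polytope Y y -> polyhedron Y y x -> d != 0 ->
    (forall j, j \in active x -> (Y *m d) j 0 <= 0) ->
  exists2 t, 0 < t & polyhedron Y y (x + t *: d) /\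
    exists2 j, j \notin active x & j \in active (x + t *: d).
Proof.
move=> bP Px d0 dact; have [j0 j0pos] := polytope_no_recession bP Px d0.
pose r j := (y j 0 - (Y *m x) j 0) / (Y *m d) j 0.
case: (arg_minP r (P := fun j => 0 < (Y *m d) j 0) j0pos) => j jpos jmin.
have jNact : j \notin active x.
  by apply/negP => /dact; rewrite leNgt jpos.
have r0 : 0 < r j.
  rewrite divr_gt0// subr_gt0 lt_neqAle Px andbT.
  by rewrite inE in jNact.
exists (r j) => //; split.
  move=> k l; rewrite ord1 mulmx_lineE.
  have [kpos|kneg] := ltrP 0 ((Y *m d) k 0).
    by rewrite -lerBrDl -ler_pdivlMr// jmin.
  by rewrite (le_trans _ (Px k 0))// gerDl pmulr_rle0.
exists j => //; rewrite inE mulmx_lineE /r.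
by rewrite divfK ?lt0r_neq0// subrKC.
Qed.

Lemma rows_atM (I : {set 'I_m}) p (A : 'M[R]_(n, p)) :
  rows_at I Y *m A = rows_at I (Y *m A).
Proof. by rewrite /rows_at mul_rowsub_mx. Qed.

Lemma face_active x : polyhedron Y y x -> face Y y (active x) x.
Proof.
move=> Px; split=> // j k; rewrite ord1 rows_atM !mxE.
by have := enum_valP j; rewrite inE mxE => /eqP ->.
Qed.

Hypothesis simpY : entirely_simple Y y.

Lemma rank_active x : polyhedron Y y x ->
  \rank (rows_at (active x) Y) = #|active x|.
Proof. by move=> Px; apply: simpY; exists x; exact: face_active. Qed.

Lemma card_active_le x : polyhedron Y y x -> (#|active x| <= n)%N.
Proof. by move=> Px; rewrite -rank_active// rank_leq_col. Qed.

Lemma climb_to_vertex c x :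
    is_polytope Y y -> polyhedron Y y x ->
  exists2 x', polyhedron Y y x' & '[c, x] <= '[c, x'] /\ #|active x'| = n.
Proof.
move=> bP; have [k] := ubnP (n - #|active x|); elim: k x => // k IHk x xk Px.
have := card_active_le Px; rewrite leq_eqVlt => /predU1P[xn|xn].
  by exists x.
have [d0 d00 dker] : exists2 d : 'cV[R]_n, d != 0 & rows_at (active x) Y *m d = 0.
  (* Fewer than [n] active rows leave a nonzero kernel; the transposes are there because [kermx] is
     a left kernel. *)
  set A := rows_at _ Y; pose K := kermx A^T.
  have K0 : K != 0.
    by rewrite -mxrank_eq0 mxrank_ker mxrank_tr rank_active// subn_eq0 -ltnNge.
  exists (nz_row K)^T; first by rewrite trmx_eq0 nz_row_eq0.
  apply: trmx_inj; rewrite trmx_mul trmxK trmx0; apply/sub_kermxP.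
  exact: nz_row_sub.
(* The kernel is symmetric, so the sign of the direction can be chosen so that [c] does not
   decrease. *)
have [d [d0' dker' cd]] : exists d : 'cV[R]_n, [/\ d != 0,
    rows_at (active x) Y *m d = 0 & 0 <= '[c, d]].
  have [cd|cd] := lerP 0 '[c, d0]; first by exists d0.
  exists (- d0); rewrite oppr_eq0 mulmxN dker oppr0; split=> //.
  by rewrite mulmxN mxE oppr_ge0 ltW.
have dact j : j \in active x -> (Y *m d) j 0 = 0.
  move=> jx; have /(congr1 (fun M : 'cV_ _ => M (enum_rank_in jx j) 0)) := dker'.
  by rewrite rows_atM mxE [RHS]mxE enum_rankK_in.
have [|t t0 [Px' [j jx jx']]] := ratio_step bP Px d0'.
  by move=> j /dact ->.
have sub : active x \proper active (x + t *: d).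
  apply/properP; split; last by exists j.
  apply/fintype.subsetP => l lx; rewrite inE mulmx_lineE dact// mulr0 addr0.
  by rewrite inE in lx.
have [] := IHk (x + t *: d).
- by move: (proper_card sub) (card_active_le Px') xk => *; lia.
- by [].
move=> x' Px'' [cx' nx']; exists x' => //; split=> //; apply: le_trans cx'.
by rewrite pair_lineE lerDl mulr_ge0// ltW.
Qed.

Definition vertex_row i (k : 'I_n) : 'I_m :=
  enum_val (cast_ord (esym (card_vertex_set i)) k).

Lemma vertex_rowsE i p (A : 'M[R]_(m, p)) k l :
  vertex_rows i A k l = A (vertex_row i k) l.
Proof. by rewrite castmxE !mxE cast_ord_id. Qed.

Lemma vertex_rowP i j : j \in vertex_set i -> exists k, j = vertex_row i k.
Proof.
move=> ji; exists (cast_ord (card_vertex_set i) (enum_rank_in ji j)).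
by rewrite /vertex_row cast_ordK enum_rankK_in.
Qed.

Lemma vertex_rowsM i p (A : 'M[R]_(n, p)) :
  vertex_rows i (Y *m A) = vertex_rows i Y *m A.
Proof.
apply/matrixP => k l; rewrite vertex_rowsE !mxE.
by apply: eq_bigr => h _; rewrite vertex_rowsE.
Qed.

Lemma vertex_mx_uniq i x :
  (forall j, j \in vertex_set i -> (Y *m x) j 0 = y j 0) ->
  x = vertex_mx i *m y.
Proof.
move=> xE; rewrite vertex_mxM; suff -> : vertex_rows i y = vertex_rows i Y *m x.
  by rewrite mulKmx// vertex_rows_unit.
apply/colP => k; rewrite -vertex_rowsM !vertex_rowsE xE//; exact: enum_valP.
Qed.

Lemma vertex_of_active x : polyhedron Y y x -> #|active x| = n ->
  exists i, x = vertex_mx i *m y.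
Proof.
move=> Px xn; have xV : active x \in vertex_sets Y y.
  by rewrite inE xn eqxx; apply/asboolP; exists x; exact: face_active.
exists (enum_rank_in xV (active x)); apply: vertex_mx_uniq => j.
by rewrite /vertex_set enum_rankK_in// inE => /eqP.
Qed.

Lemma vertex_in_face i : face Y y (vertex_set i) (vertex_mx i *m y).
Proof.
have := enum_valP i; rewrite inE => /andP[_ /asboolP[x [Px xI]]].
rewrite -/(vertex_set i) in xI; rewrite -(@vertex_mx_uniq i x)// => j ji.
apply/eqP; rewrite eq_le Px/=; have := xI (enum_rank_in ji j) 0.
by rewrite rows_atM mxE [leRHS]mxE enum_rankK_in.
Qed.

(** Simplicity allows at most [n] active rows, and the vertex set already supplies [n]. All other
    rows are thus slack at the vertex, which makes a positive step along each edge possible. *)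
Lemma active_vertex i : active (vertex_mx i *m y) = vertex_set i.
Proof.
have [Px xI] := vertex_in_face i; apply/esym/eqP; rewrite eqEcard.
rewrite card_vertex_set card_active_le// andbT; apply/fintype.subsetP => j ji.
have [k ->] := vertex_rowP ji; rewrite inE -!vertex_rowsE vertex_rowsM vertex_mxM.
by rewrite mulKVmx ?vertex_rows_unit.
Qed.

Lemma polytope_vertex_maximizer c :
    is_polytope Y y -> polyhedron Y y !=set0 ->
  exists i, forall x, polyhedron Y y x -> '[c, x] <= '[c, vertex_mx i *m y].
Proof.
move=> bP [x0 Px0].
have climb x : polyhedron Y y x -> exists i, '[c, x] <= '[c, vertex_mx i *m y].
  move=> Px; have [x' Px' [le_cx nx']] := climb_to_vertex c bP Px.
  by have [i x'i] := vertex_of_active Px' nx'; exists i; rewrite -x'i.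
have [i0 _] := climb _ Px0.
case: (arg_maxP (fun i => '[c, vertex_mx i *m y]) (isT : predT i0)) => i _ imax.
by exists i => x /climb[k /le_trans]; apply; exact: imax.
Qed.

(* Otherwise some coefficient [l 0 k] would be negative, and relaxing the
   [k]-th vertex constraint would yield an edge along which [c] increases. *)
Lemma vertex_cone_cover c :
    is_polytope Y y -> polyhedron Y y !=set0 ->
  exists i, exists2 l : 'rV[R]_n, forall k, 0 <= l 0 k & c = l *m vertex_rows i Y.
Proof.
move=> bP P0; have [i imax] := polytope_vertex_maximizer c bP P0.
have Bu := vertex_rows_unit i simpY; set B := vertex_rows i Y in Bu.
exists i, (c *m invmx B); last by rewrite mulmxKV.
move=> k; rewrite leNgt; apply/negP => lk.
(* The edge direction solves [B *m d = - delta_mx k 0]: constraint [k] is relaxed, the other vertex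
   constraints stay tight, and ['[c, d]] is minus the negative coefficient. *)
pose d : 'cV_n := - (invmx B *m delta_mx k 0).
have cd : 0 < '[c, d] by rewrite mulmxN mulmxA -colE mxE oppr_gt0 mxE.
have d0 : d != 0 by apply: contraTneq cd => ->; rewrite mulmx0 mxE ltxx.
have [Pv _] := vertex_in_face i.
have [|t t0 [/imax]] := ratio_step bP Pv d0.
  move=> j; rewrite active_vertex => /vertex_rowP[h ->].
  rewrite -vertex_rowsE vertex_rowsM mulmxN mulKVmx// !mxE.
  by rewrite oppr_le0 ler0n.
by rewrite leNgt pair_lineE ltrDl mulr_gt0.
Qed.

End Polytope.

(** * The configuration domain and the vertex representation *)

Lemma config_domainP (R : realType) m n (Y : 'M[R]_(m, n)) (s y : 'cV[R]_m) :
  config_domain Y s y ->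
  forall i : 'I_(nvertices Y s), polyhedron Y y (vertex_mx i *m y).
Proof.
move=> yE i j k; rewrite mulmxA -subr_le0.
have yEi : submxcol (config_mx Y s *m y) i = (Y *m vertex_mx i - 1%:M) *m y.
  by rewrite mxcol_mul mxcolK.
have -> : (Y *m vertex_mx i *m y) j k - y j k =
    submxcol (config_mx Y s *m y) i j k.
  by rewrite yEi mulmxBl mul1mx !mxE.
by rewrite mxE (le_trans (yE _ _))// mxE.
Qed.

Lemma polyhedron_convex (R : realType) m n (Y : 'M[R]_(m, n)) (y : 'cV[R]_m) :
  convex_set (polyhedron Y y).
Proof.
move=> a b t; rewrite !inE => Pa Pb j k.
rewrite mulmxDr -!scalemxAr mxE [X in X + _]mxE [X in _ + X]mxE.
have -> : y j k = t%:num * y j k + (1 - t%:num) * y j k by ring.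
by rewrite lerD// ler_wpM2l// subr_ge0.
Qed.

Theorem theorem2 (R : realType) (m n : nat) (n_ge1 : (1 <= n)%N)
    (Y : 'M[R]_(m, n)) (sigma : 'cV[R]_m)
    (P_neq0 : polyhedron Y sigma !=set0)
    (P_simple : entirely_simple Y sigma)
    (P_polytope : is_polytope Y sigma)
    (y : 'cV[R]_m) (yE : config_domain Y sigma y) :
  polyhedron Y y =
  convex_hull [set vertex_mx i *m y | i in [set: 'I_(nvertices Y sigma)]].
Proof.
have Py := config_domainP yE.
apply/seteqP; split => [x Px|]; last first.
  apply: smallest_sub; first exact: polyhedron_convex.
  by move=> _ [i _ <-].
apply: contrapT => /convex_hull_separation[c cx].
have [i [l l0 cE]] := vertex_cone_cover P_simple c P_polytope P_neq0.
(* Both pairings are expressed through [l]: ['[c, x]] weights the entries of [Y *m x] in the vertex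
   rows, and ['[c, vertex_mx i *m y]] weights those of [y]. *)
have /= := cx i; rewrite ltNge => /negP; apply; rewrite vertex_mxM cE -!mulmxA.
rewrite mulKVmx ?vertex_rows_unit// -vertex_rowsM !mxE.
apply: ler_sum => k _; rewrite ler_wpM2l// !vertex_rowsE; exact: Px.
Qed.
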